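(* Let $(A,+,\cdot)$ be a unital ring, and let $p,\pi\in\operatorname{End}((A,\cdot))$ be monoid endomorphisms such that $p(u)\pi(v)=\pi(v)p(u)$ for all $u,v\in A$. (1) Define a binary operation $\star\colon A\times A\to A$ by $$u\star v:=\pi(v)u-p(u)\pi(v)+p(u)v.$$ Suppose that for all $u,v\in A$ $$p(u\star v)=p(u)p(v),\qquad \pi(u\star v)=\pi(v)\pi(u).$$ Then $(A,\star)$ is a monoid. (2) Furthermore, let $G$ and $H$ be subgroups of the group of units of $A$, let $U:=p^{-1}(G)\cap\pi^{-1}(H)$, and for any $u\in U$ define $$\operatorname{inv}_\star(u):=\pi(u)^{-1}-p(u)^{-1}\pi(u)^{-1}u+p(u)^{-1}.$$ If, in addition to the identities $p(u\star v)=p(u)p(v)$ and $\pi(u\star v)=\pi(v)\pi(u)$ for all $u,v\in A$, the conditions $$p(\operatorname{inv}_\star(u))=p(u)^{-1},\qquad \pi(\operatorname{inv}_\star(u))=\pi(u)^{-1}$$ are satisfied for all $u\in U$, then $(U,\star,\cdot)$ forms a right wire.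
   Context: A right wire is a triple $(W,\star,\circ)$ such that $(W,\star)$ is a group, $(W,\circ)$ is a semigroup, and $(b\star c)\circ a=(b\circ a)\star a^{-1}\star(c\circ a)$ for all $a,b,c\in W$, where $a^{-1}$ here denotes the inverse of $a$ with respect to $\star$. Monoid endomorphisms of $(A,\cdot)$ fix the unit $1$. In the definition of $\operatorname{inv}_\star$ and in the conditions on it, $p(u)^{-1}$ and $\pi(u)^{-1}$ denote multiplicative inverses in the ring $A$; $p^{-1}(G)$ and $\pi^{-1}(H)$ denote preimages. *)

(* Defs.v *)
From HB Require Import structures.
From mathcomp Require Import all_boot all_order all_algebra.
From mathcomp Require Import boolp classical_sets.
Set Implicit Arguments.
Unset Strict Implicit.
Unset Printing Implicit Defensive.
Import GRing.Theory.
Local Open Scope classical_set_scope.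
Local Open Scope ring_scope.

(* The carrier of each algebraic structure is a subset W of an ambient type on
   which the operations are defined; closure of W under them is part of the
   structure. *)
Section Structures.
Context {T : Type}.
Implicit Types (W : set T) (op star circ : T -> T -> T).

Definition is_semigroup W op : Prop :=
  (forall a b, W a -> W b -> W (op a b)) /\
  (forall a b c, W a -> W b -> W c -> op a (op b c) = op (op a b) c).

Definition is_identity W op (e : T) : Prop :=
  W e /\ forall a, W a -> op e a = a /\ op a e = a.

Definition is_monoid W op : Prop :=
  is_semigroup W op /\ exists e, is_identity W op e.

Definition is_group W op (e : T) (inv : T -> T) : Prop :=
  [/\ is_semigroup W op, is_identity W op e
    & forall a, W a -> [/\ W (inv a), op (inv a) a = e & op a (inv a) = e]].

(* The identity e and, on W, the inversion inv are determined by star. *)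
Definition right_wire W star circ : Prop :=
  exists (e : T) (inv : T -> T),
    [/\ is_group W star e inv, is_semigroup W circ
      & forall a b c, W a -> W b -> W c ->
          circ (star b c) a = star (star (circ b a) (inv a)) (circ c a)].

End Structures.

Section Rings.
Context {A : pzRingType}.
Implicit Types (x y u v : A) (G : set A) (p pi : A -> A).

Definition is_inverse x y : Prop := x * y = 1 /\ y * x = 1.

Definition ring_units : set A := [set x | exists y, is_inverse x y].

(* The library provides x^-1 only on unitRingType, which excludes the zero
   ring. The value 0 at a nonunit x is a placeholder. *)
Definition ring_inv x : A := xget 0 [set y | is_inverse x y].

Definition unit_subgroup G : Prop :=
  [/\ G `<=` ring_units, G 1, forall x y, G x -> G y -> G (x * y)
    & forall x, G x -> G (ring_inv x)].

Definition star p pi u v : A := pi v * u - p u * pi v + p u * v.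

Definition inv_star p pi u : A :=
  ring_inv (pi u) - ring_inv (p u) * ring_inv (pi u) * u + ring_inv (p u).

End Rings.

(* Main.v *)
Require Import Defs.
From HB Require Import structures.
From mathcomp Require Import all_boot all_order all_algebra.
From mathcomp Require Import boolp classical_sets.
Set Implicit Arguments.
Unset Strict Implicit.
Unset Printing Implicit Defensive.
Import GRing.Theory.
Local Open Scope classical_set_scope.
Local Open Scope ring_scope.

(** Put d(u) = u - p(u). The hypothesis on p turns the definition of [star] into the twisted Leibniz
    rule d(u star v) = pi(v) d(u) + p(u) d(v). Since p is multiplicative on [star], pi is
    anti-multiplicative and their values commute, this rule is associative; [starA] checks it by
    direct expansion. The formula for [inv_star] is what solving u star x = 1 gives once pi(x) =
    pi(u)^-1 is imposed. The wire law ([star_mulr]) follows by expansion, because p and pi turn both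
    [star] and the ring product into products, so the factors p(u), pi(u) cancel their inverses. *)

Lemma ring_invP (A : pzRingType) (x : A) :
  ring_units x -> is_inverse x (ring_inv x).
Proof. by move=> [y xy]; rewrite /ring_inv; case: xgetP => [_ _ //|/(_ y)]. Qed.

Lemma is_inverse_comm (A : pzRingType) (x x' y : A) :
  is_inverse x x' -> GRing.comm x y -> GRing.comm x' y.
Proof.
move=> [xx' x'x] xy.
by rewrite /GRing.comm -[y in LHS]mulr1 -xx' !mulrA -(mulrA x') -xy
  mulrA x'x mul1r.
Qed.

Section Star.
Variables (A : pzRingType) (p pi : A -> A).
Hypotheses (p_end : GRing.monoid_morphism p)
  (pi_end : GRing.monoid_morphism pi).
Hypothesis p_pi_comm : forall u v : A, p u * pi v = pi v * p u.
Hypothesis p_star : forall u v : A, p (star p pi u v) = p u * p v.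
Hypothesis pi_star : forall u v : A, pi (star p pi u v) = pi v * pi u.

(** Once p and pi are pushed through the inner [star], both sides have the same five monomials, up
    to moving values of p past values of pi. *)
Lemma starA : associative (star p pi).
Proof.
move=> u v w; rewrite {1 3}/star pi_star p_star /star.
rewrite !mulrDr !mulrN !mulrA !p_pi_comm.
by rewrite !addrA.
Qed.

Lemma star1l : left_id 1 (star p pi).
Proof. by move=> v; rewrite /star p_end.1 mulr1 !mul1r subrr add0r. Qed.

Lemma star1r : right_id 1 (star p pi).
Proof. by move=> u; rewrite /star pi_end.1 !mulr1 mul1r subrK. Qed.

Section Inverse.
Variable u : A.
Hypotheses (pu_unit : ring_units (p u)) (piu_unit : ring_units (pi u)).
Hypothesis p_inv : p (inv_star p pi u) = ring_inv (p u).
Hypothesis pi_inv : pi (inv_star p pi u) = ring_inv (pi u).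

Lemma star_invr : star p pi u (inv_star p pi u) = 1.
Proof.
have [pV _] := ring_invP pu_unit.
rewrite {1}/star pi_inv /inv_star !mulrDr mulrN !mulrA pV mul1r.
by rewrite addrA addrA subrK subrr add0r.
Qed.

(** Here p(u)^-1 has to pass pi(u), which it does because p(u) commutes with pi(u). *)
Lemma star_invl : star p pi (inv_star p pi u) u = 1.
Proof.
have pVpi : GRing.comm (ring_inv (p u)) (pi u).
  exact: is_inverse_comm (ring_invP pu_unit) (p_pi_comm u u).
have [piV _] := ring_invP piu_unit.
rewrite /star p_inv /inv_star !mulrDr mulrN !mulrA -pVpi.
by rewrite -[X in _ - X * u]mulrA piV mulr1 addrK subrK.
Qed.

(** This is the left factor on the right-hand side of the wire law. Since p(b u) = p(b) p(u), the
    two terms p(b) p(u) pi(u)^-1 cancel. *)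
Lemma star_mul_inv (b : A) :
  star p pi (b * u) (inv_star p pi u) =
  ring_inv (pi u) * b * u - p b * ring_inv (pi u) * u + p b.
Proof.
have [pV _] := ring_invP pu_unit.
rewrite {1}/star pi_inv p_end.2 /inv_star !mulrDr mulrN.
rewrite !mulrA -(mulrA (p b) (p u) (ring_inv (p u))) pV mulr1.
by rewrite addrA addrA subrK.
Qed.

Lemma star_mulr (b c : A) :
  star p pi b c * u =
  star p pi (star p pi (b * u) (inv_star p pi u)) (c * u).
Proof.
have [piV _] := ring_invP piu_unit.
(* Under p the factor u cancels, so the outer [star] sees the same left coefficient p(b) as b star c
   does. *)
have p_left : p (star p pi (b * u) (inv_star p pi u)) = p b.
  by rewrite p_star p_inv p_end.2 -mulrA (ring_invP pu_unit).1 mulr1.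
rewrite {2}/star p_left star_mul_inv pi_end.2.
rewrite !mulrDr mulrN !mulrA -(mulrA (pi c)) piV mulr1.
(* Moving p(b) to the front lets pi(u) meet pi(u)^-1 and makes the two terms p(b) pi(c) pi(u)
   cancel; what remains is (b star c) u, expanded. *)
rewrite -(mulrA (pi c) (pi u) (p b)) -p_pi_comm mulrA -(p_pi_comm b c).
rewrite -(mulrA (p b * pi c)) piV mulr1 addrK.
by rewrite /star !mulrDl mulNr.
Qed.

End Inverse.

End Star.

Theorem proposition2p17 (A : pzRingType) (p pi : A -> A)
    (p_end : GRing.monoid_morphism p) (pi_end : GRing.monoid_morphism pi)
    (p_pi_comm : forall u v : A, p u * pi v = pi v * p u)
    (p_star : forall u v : A, p (star p pi u v) = p u * p v)
    (pi_star : forall u v : A, pi (star p pi u v) = pi v * pi u) :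
  is_monoid [set: A] (star p pi) /\
  (forall G H : set A, unit_subgroup G -> unit_subgroup H ->
     let U := p @^-1` G `&` pi @^-1` H in
     (forall u : A, U u -> p (inv_star p pi u) = ring_inv (p u)) ->
     (forall u : A, U u -> pi (inv_star p pi u) = ring_inv (pi u)) ->
     right_wire U (star p pi) (fun u v : A => u * v)).
Proof.
have sA := starA p_pi_comm p_star pi_star.
have s1l := star1l pi p_end; have s1r := star1r p pi_end.
split; first by split; [|exists 1].
move=> G H [Gu G1 GM GV] [Hu H1 HM HV] U pV piV.
exists 1, (inv_star p pi); split; [split| |].
(* U is closed because p and pi carry [star] to products, in opposite orders, inside the subgroups G
   and H. *)
- split=> [a b [Ga Ha] [Gb Hb]|a b c _ _ _]; last exact: sA.
  by split; rewrite /= ?p_star ?pi_star; [apply: GM|apply: HM].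
- by split=> //; split; rewrite /= ?p_end.1 ?pi_end.1.
- move=> a Ua; have [Ga Ha] := Ua; split.
  (* The conditions on [inv_star] put its images under p and pi at inverses of elements of G and H,
     so it stays in U. *)
  + by split; rewrite /= ?pV ?piV //; [apply: GV|apply: HV].
  + exact: star_invl (Gu _ Ga) (Hu _ Ha) (pV _ Ua).
  + exact: star_invr (Gu _ Ga) (piV _ Ua).
- split=> [a b [Ga Ha] [Gb Hb]|a b c _ _ _]; last exact: mulrA.
  by split; rewrite /= ?p_end.2 ?pi_end.2; [apply: GM|apply: HM].
- move=> a b c Ua _ _; have [Ga Ha] := Ua.
  exact: star_mulr (Gu _ Ga) (Hu _ Ha) (pV _ Ua) (piV _ Ua) b c.
Qed.
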